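(* Let $S\subset\mathbb{R}^d$ be nonempty and closed. For $\{f,f^n,n\in\mathbb{N}\}\subset\mathrm{usc\text{-}fcns}(S)$ with $f^n\to f$, we have: (i) If each $f^n$ is nondecreasing in the sense that $f^n(x)\leq f^n(y)$ for $x\in S$, $y\in\operatorname{int}S$, with $x\leq y$, then $f$ is also nondecreasing in the same sense. If $S$ is a box, then $\operatorname{int}S$ can be replaced by $S$ (in both the hypothesis and the conclusion). (ii) If each $f^n$ is nonincreasing in the sense that $f^n(x)\geq f^n(y)$ for $x\in\operatorname{int}S$, $y\in S$, with $x\leq y$, then $f$ is also nonincreasing in the same sense. If $S$ is a box, then $\operatorname{int}S$ can be replaced by $S$ (in both the hypothesis and the conclusion).
   Context: $\mathrm{usc\text{-}fcns}(S)$ is the set of upper semicontinuous functions $f:S\to[-\infty,\infty]$ with $f\not\equiv-\infty$. Convergence $f^n\to f$ means hypo-convergence (equivalently, convergence in the Attouch-Wets distance between hypographs): $\limsup f^n(x^n)\leq f(x)$ for all $x\in S$ and all $x^n\in S\to x$, and for every $x\in S$ there is $x^n\in S\to x$ with $\liminf f^n(x^n)\geq f(x)$. The inequality $x\leq y$ between vectors is componentwise; $\operatorname{int}S$ is the interior of $S$ in $\mathbb{R}^d$. A box in $\mathbb{R}^d$ is a set $S=[\alpha_1,\beta_1]\times\dots\times[\alpha_d,\beta_d]$ with $-\infty\leq\alpha_i<\beta_i\leq\infty$, where in the case of $\alpha_i=-\infty$ and/or $\beta_i=\infty$ the closed intervals are replaced by (half-)open intervals, so that $S\subset\mathbb{R}^d$.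 *)

(* Defs.v *)
From mathcomp Require Import all_boot all_order all_algebra.
From mathcomp Require Import all_classical all_reals all_analysis.

Set Implicit Arguments.
Unset Strict Implicit.
Unset Printing Implicit Defensive.

Import Order.TTheory GRing.Theory Num.Theory.
Import numFieldNormedType.Exports.

Local Open Scope classical_set_scope.
Local Open Scope ring_scope.
Local Open Scope ereal_scope.

(* A function S -> [-oo, +oo] is represented by a total function on R^d; none
   of the notions below depends on its values outside of S. *)

(* Upper semicontinuity relative to S; the pointwise counterpart, for the
   subspace topology of S, of the library's [lower_semicontinuous]. *)
Definition usc_on (R : realType) (d : nat) (S : set 'rV[R]_d)
    (f : 'rV[R]_d -> \bar R) : Prop :=
  forall (x : 'rV[R]_d) (a : R), S x -> f x < a%:E ->
    \forall y \near within S (nbhs x), f y < a%:E.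

Definition usc_fcns (R : realType) (d : nat) (S : set 'rV[R]_d) :
    set ('rV[R]_d -> \bar R) :=
  [set f | usc_on S f /\ exists2 x, S x & f x != -oo].

Definition hypo_cvg (R : realType) (d : nat) (S : set 'rV[R]_d)
    (fn : nat -> 'rV[R]_d -> \bar R) (f : 'rV[R]_d -> \bar R) : Prop :=
  (forall (x : 'rV[R]_d) (xn : nat -> 'rV[R]_d),
     S x -> (forall n, S (xn n)) -> xn n @[n --> \oo] --> x ->
     limn_esup (fun n => fn n (xn n)) <= f x) /\
  (forall x : 'rV[R]_d, S x ->
     exists xn : nat -> 'rV[R]_d,
       [/\ forall n, S (xn n), xn n @[n --> \oo] --> x &
           f x <= limn_einf (fun n => fn n (xn n))]).

Definition vec_le (R : realType) (d : nat) (x y : 'rV[R]_d) : Prop :=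
  forall i : 'I_d, (x ord0 i <= y ord0 i)%R.

Definition nondecreasing_from_to (R : realType) (d : nat)
    (A B : set 'rV[R]_d) (f : 'rV[R]_d -> \bar R) : Prop :=
  forall x y : 'rV[R]_d, A x -> B y -> vec_le x y -> f x <= f y.

Definition nonincreasing_from_to (R : realType) (d : nat)
    (A B : set 'rV[R]_d) (f : 'rV[R]_d -> \bar R) : Prop :=
  forall x y : 'rV[R]_d, A x -> B y -> vec_le x y -> f y <= f x.

(* Coordinates of x are finite, so comparing them in \bar R with infinite
   endpoints yields exactly the (half-)open intervals of R^d. *)
Definition is_box (R : realType) (d : nat) (S : set 'rV[R]_d) : Prop :=
  exists alpha beta : 'I_d -> \bar R,
    (forall i, alpha i < beta i) /\
    S = [set x | forall i, alpha i <= (x ord0 i)%:E <= beta i].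

(* Main.v *)
(** If [f x <= f y] is to be shown for [x <= y], take a recovery sequence
    [z n --> x] and move the other point along with it: [max y (z n)] lies above
    [z n] and tends to [max y x = y].  Monotonicity of the [fn n] along these
    two sequences then passes to the limit.  The nonincreasing case is symmetric,
    with [min] in place of [max], and a box is stable under both operations. *)

Require Import Defs.
From mathcomp Require Import all_boot all_order all_algebra.
From mathcomp Require Import all_classical all_reals all_analysis.
From mathcomp Require Import lra.
Import Order.TTheory GRing.Theory Num.Theory.
Import numFieldNormedType.Exports.
Local Open Scope classical_set_scope.
Local Open Scope ring_scope.

Set Implicit Arguments.
Unset Strict Implicit.

(** Mixes the two limits because hypo-convergence bounds [f] above by a liminf along a recovery
    sequence and below by a limsup along any sequence. *)
Lemma limn_einf_le_esup (R : realType) (u v : nat -> \bar R) :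
  (\forall n \near \oo, (u n <= v n)%E) -> (limn_einf u <= limn_esup v)%E.
Proof.
move=> uv; rewrite limn_einf_lim limn_esup_lim.
apply: lee_lim; [exact: is_cvg_einfs|exact: is_cvg_esups|].
apply: filterS uv => n uvn.
apply: (@le_trans _ _ (u n)).
  by apply: ereal_inf_lbound; exists n => /=.
by apply: (le_trans uvn); apply: ereal_sup_ubound; exists n => /=.
Qed.

(** The map [g] carries a recovery sequence at [x] to a competitor at [y]. Its conditions are local
    at [x], since for interior points [g z] is known to lie in [S] only for [z] close to [x]. *)
Lemma hypo_cvg_le (R : realType) (d : nat) (S : set 'rV[R]_d)
    (fn : nat -> 'rV[R]_d -> \bar R) (f : 'rV[R]_d -> \bar R)
    (g : 'rV[R]_d -> 'rV[R]_d) (x y : 'rV[R]_d) :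
  hypo_cvg S fn f -> S x -> S y -> g z @[z --> x] --> y ->
  (\forall z \near x, S z -> S (g z) /\ forall n, (fn n z <= fn n (g z))%E) ->
  (f x <= f y)%E.
Proof.
move=> [fn_sup fn_inf] Sx Sy gxy gS.
have [z [Sz zx fx]] := fn_inf _ Sx.
(* The limsup condition needs every term in [S], but [g (z n)] is there only eventually; [y] serves
   as default for the other indices. *)
have gz n : exists w, S w /\ (S (g (z n)) -> w = g (z n)).
  have [Sg|nSg] := pselect (S (g (z n))); first by exists (g (z n)).
  by exists y.
pose w n := sval (cid (gz n)).
have Sw n : S (w n) by rewrite /w; case: cid => ? [].
have wE n : S (g (z n)) -> w n = g (z n) by rewrite /w; case: cid => ? [].
have zgS : \forall n \near \oo,
    S (g (z n)) /\ forall m, (fn m (z n) <= fn m (g (z n)))%E.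
  have nearz A : nbhs x A -> \forall n \near \oo, A (z n) by exact: zx.
  by apply: filterS (nearz _ gS) => n /(_ (Sz n)).
have wy : w n @[n --> \oo] --> y.
  have gzy : g (z n) @[n --> \oo] --> y by exact: (cvg_comp _ _ zx gxy).
  apply: cvg_trans gzy; apply: near_eq_cvg.
  by apply: filterS zgS => n [/wE <-].
apply: (le_trans fx); apply: le_trans (fn_sup y w Sy Sw wy).
by apply: limn_einf_le_esup; apply: filterS zgS => n [/wE -> ].
Qed.

(** With [y] fixed, [op] is 1-Lipschitz in its second argument, so the same radius [e] works on both
    sides. *)
Lemma cvg_map2_mx (R : realType) (d : nat) (op : R -> R -> R)
    (x y : 'rV[R]_d) :
  (forall a b c, `|op a b - op a c| <= `|b - c|) ->
  (forall i, op (y ord0 i) (x ord0 i) = y ord0 i) ->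
  map2_mx op y z @[z --> x] --> y.
Proof.
move=> op_lip opyx; apply/(@cvg_ballP _ _ _ _ (nbhs_filter x)) => e e0.
have xe : nbhs x (ball x e) by exact: nbhsx_ballx.
apply: filterS xe => z [_ xz]; split=> // i j; rewrite !ord1 mxE.
rewrite -[X in ball X]opyx.
exact: le_lt_trans (op_lip _ _ _) (xz ord0 j).
Qed.

Lemma maxr_lip (R : realType) (a b c : R) :
  `|Num.max a b - Num.max a c| <= `|b - c|.
Proof.
(* Both signs of [b - c] are bounded by [|b - c|], which can then be treated as an atom by linear
   arithmetic. *)
have := ler_norm (b - c); have := ler_norm (c - b); rewrite distrC ler_norml.
by case: (leP a b); case: (leP a c) => *; apply/andP; split; lra.
Qed.

Lemma minr_lip (R : realType) (a b c : R) :
  `|Num.min a b - Num.min a c| <= `|b - c|.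
Proof.
have := ler_norm (b - c); have := ler_norm (c - b); rewrite distrC ler_norml.
by case: (leP a b); case: (leP a c) => *; apply/andP; split; lra.
Qed.

Lemma cvg_map2_max (R : realType) (d : nat) (x y : 'rV[R]_d) :
  vec_le x y -> map2_mx Num.max y z @[z --> x] --> y.
Proof.
move=> xy; apply: cvg_map2_mx => [|i]; first exact: maxr_lip.
by apply/max_idPl; exact: xy.
Qed.

Lemma cvg_map2_min (R : realType) (d : nat) (x y : 'rV[R]_d) :
  vec_le y x -> map2_mx Num.min y z @[z --> x] --> y.
Proof.
move=> yx; apply: cvg_map2_mx => [|i]; first exact: minr_lip.
by apply/min_idPl; exact: yx.
Qed.

Lemma vec_le_map2_max (R : realType) (d : nat) (y z : 'rV[R]_d) :
  vec_le z (map2_mx Num.max y z).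
Proof. by move=> i; rewrite mxE le_max lexx orbT. Qed.

Lemma vec_le_map2_min (R : realType) (d : nat) (y z : 'rV[R]_d) :
  vec_le (map2_mx Num.min y z) z.
Proof. by move=> i; rewrite mxE ge_min lexx orbT. Qed.

(** A box constrains each coordinate separately, and each entry of the maximum is the entry of [x]
    or of [y] at that index. *)
Lemma box_map2_max (R : realType) (d : nat) (S : set 'rV[R]_d)
    (x y : 'rV[R]_d) :
  is_box S -> S x -> S y -> S (map2_mx Num.max x y).
Proof.
move=> [al [be [_ ->]]] Sx Sy i; rewrite mxE.
by case: (leP (x ord0 i) (y ord0 i)) => _; [exact: Sy|exact: Sx].
Qed.

Lemma box_map2_min (R : realType) (d : nat) (S : set 'rV[R]_d)
    (x y : 'rV[R]_d) :
  is_box S -> S x -> S y -> S (map2_mx Num.min x y).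
Proof.
move=> [al [be [_ ->]]] Sx Sy i; rewrite mxE.
by case: (leP (x ord0 i) (y ord0 i)) => _; [exact: Sx|exact: Sy].
Qed.

Unset Implicit Arguments.
Set Strict Implicit.

Theorem proposition4p3 (R : realType) (d : nat) (S : set 'rV[R]_d)
    (f : 'rV[R]_d -> \bar R) (fn : nat -> 'rV[R]_d -> \bar R)
    (S_nonempty : S !=set0) (S_closed : closed S)
    (f_usc : usc_fcns S f) (fn_usc : forall n : nat, usc_fcns S (fn n))
    (fn_cvg : hypo_cvg S fn f) :
  (((forall n : nat, nondecreasing_from_to S (interior S) (fn n)) ->
      nondecreasing_from_to S (interior S) f) /\
   (is_box S ->
      (forall n : nat, nondecreasing_from_to S S (fn n)) ->
      nondecreasing_from_to S S f)) /\
  (((forall n : nat, nonincreasing_from_to (interior S) S (fn n)) ->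
      nonincreasing_from_to (interior S) S f) /\
   (is_box S ->
      (forall n : nat, nonincreasing_from_to S S (fn n)) ->
      nonincreasing_from_to S S f)).
Proof.
split; split.
- move=> fn_nd x y Sx Sy xy; have maxy := cvg_map2_max xy.
  apply: (hypo_cvg_le fn_cvg Sx (interior_subset Sy) maxy).
  (* [S] need not be stable under [max]; instead, [max y z] tends to the interior point [y], so it
     enters the open set [S°]. *)
  have gS : \forall z \near x, S° (map2_mx Num.max y z).
    by apply: maxy; exact: nbhs_interior.
  apply: filterS gS => z Sg Sz; split; first exact: interior_subset.
  by move=> n; apply: fn_nd => //; exact: vec_le_map2_max.
- move=> S_box fn_nd x y Sx Sy xy.
  apply: (hypo_cvg_le fn_cvg Sx Sy (cvg_map2_max xy)).
  (* In a box the conditions hold at every [z] in [S], near [x] or not. *)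
  apply: (@nearW _ (nbhs x)) => z Sz.
  have Sg := box_map2_max S_box Sy Sz; split=> // n.
  by apply: fn_nd => //; exact: vec_le_map2_max.
- move=> fn_ni x y Sx Sy xy; have minx := cvg_map2_min xy.
  (* The goal is [f y <= f x], so the recovery sequence is now taken at [y] and the moved point is
     the interior point [x]. *)
  apply: (hypo_cvg_le fn_cvg Sy (interior_subset Sx) minx).
  have gS : \forall z \near y, S° (map2_mx Num.min x z).
    by apply: minx; exact: nbhs_interior.
  apply: filterS gS => z Sg Sz; split; first exact: interior_subset.
  by move=> n; apply: fn_ni => //; exact: vec_le_map2_min.
- move=> S_box fn_ni x y Sx Sy xy.
  apply: (hypo_cvg_le fn_cvg Sy Sx (cvg_map2_min xy)).
  apply: (@nearW _ (nbhs y)) => z Sz.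
  have Sg := box_map2_min S_box Sx Sz; split=> // n.
  by apply: fn_ni => //; exact: vec_le_map2_min.
Qed.
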